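(* There is an absolute constant $C>0$ such that for every symmetric space $E$ on $I=[0,1]$, with $\psi(t)=\|\sigma_t\|_{E\to E}$ for $0<t\le1$, one has $$M(E)\supset\Lambda(\psi),\qquad \|x\|_{M(E)}\le C\|x\|_{\Lambda(\psi)}\quad\text{for all }x\in\Lambda(\psi).$$
   Context: $I=[0,1]$ with Lebesgue measure $\mu$. For a measurable function $z$ on $I$ or $I\times I$, $n_z(\tau)=\mu\{w:|z(w)|>\tau\}$ ($\tau>0$) is the distribution function of $|z|$ (on $I\times I$, $\mu$ is two-dimensional Lebesgue measure); two functions are equimeasurable if their distribution functions coincide; $z^*$ is the left-continuous non-increasing rearrangement of $|z|$ on $(0,1]$. A symmetric space on $I$ is a nonzero Banach space $E$ of (classes of) measurable functions on $I$ such that: (a) $y\in E$ and $|x|\le|y|$ a.e. imply $x\in E$ and $\|x\|_E\le\|y\|_E$; (b) $y\in E$ and $x$ equimeasurable with $y$ imply $x\in E$ and $\|x\|_E=\|y\|_E$. $E(I\times I)$ denotes the space of measurable $z$ on $I\times I$ with $z^*\in E$, normed by $\|z\|_{E(I\times I)}=\|z^*\|_E$. For measurable $x,y$ on $I$, $(x\otimes y)(s,t)=x(s)y(t)$. The multiplicator $M(E)$ is the set of all measurable $x$ on $I$ such that $x\otimes y\in E(I\times I)$ for every $y\in E$, with norm $\|x\|_{M(E)}=\sup\{\|x\otimes y\|_{E(I\times I)}:\|y\|_E\le1\}$. For $t>0$ the dilation operator is $\sigma_t y(u)=y(u/t)\chi_{[0,1]}(u/t)$, $u\in I$. For a positive nondecreasing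 function $\psi$ on $(0,1]$ (set $\psi(0)=0$), $\Lambda(\psi)$ is the set of measurable $x$ on $I$ with $\|x\|_{\Lambda(\psi)}=\int_0^1x^*(s)\,d\psi(s)<\infty$ (Stieltjes integral; if $\psi(0+)>0$ it includes the term $\psi(0+)\,x^*(0+)$, where $x^*(0+)=\|x\|_{L_\infty}$). *)

(* Defs.v *)
From HB Require Import structures.
From mathcomp Require Import all_boot all_order all_algebra.
From mathcomp Require Import all_classical all_reals all_analysis.

Set Implicit Arguments.
Unset Strict Implicit.
Unset Printing Implicit Defensive.

Import Order.TTheory GRing.Theory Num.Theory.
Import numFieldNormedType.Exports.

Local Open Scope classical_set_scope.
Local Open Scope ring_scope.

(* A measurable function on I is represented by any total function that is
   measurable on I; its values outside of I never matter.  Measurability is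
   Borel measurability, which is harmless since functions are only considered
   up to almost everywhere equality on I (every Lebesgue measurable function
   is almost everywhere equal to a Borel one). *)
Definition unitI (R : realType) : set R := `[0, 1].
Arguments unitI R : clear implicits.

Definition distribution_function (R : realType) d (T : measurableType d)
    (m : set T -> \bar R) (D : set T) (z : T -> R) (tau : R) : \bar R :=
  m (D `&` [set w | tau < `|z w|]).

Definition equimeasurable (R : realType) (x y : R -> R) :=
  forall tau : R, 0 < tau ->
    distribution_function lebesgue_measure (unitI R) x tau =
    distribution_function lebesgue_measure (unitI R) y tau.

(* The strict inequality yields the left-continuous version of the
   non-increasing rearrangement of |z|.  Only the values at 0 < t <= 1 are
   meaningful (m D = 1 in all the uses below); the function is 0 elsewhere, as
   inf set0 = 0. *)
Definition rearrangement (R : realType) d (T : measurableType d)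
    (m : set T -> \bar R) (D : set T) (z : T -> R) (t : R) : R :=
  inf [set tau | 0 < tau /\ (distribution_function m D z tau < t%:E)%E].

Definition rearrangement1 (R : realType) (x : R -> R) : R -> R :=
  rearrangement lebesgue_measure (unitI R) x.

Definition rearrangement2 (R : realType) (z : R * R -> R) : R -> R :=
  rearrangement (lebesgue_measure \x lebesgue_measure)%E
    (unitI R `*` unitI R) z.

(* The vectors of the Banach space are the classes of functions: sym_rep picks
   a representative of each class, linearly and injectively up to almost
   everywhere equality.  In sym_ideal and sym_equimeasurable, x is any
   measurable function satisfying the hypothesis, and the conclusion says that
   its class is a vector v of the space, with the stated norm. *)
Record symmetric_space (R : realType) := SymmetricSpace {
  sym_car :> completeNormedModType R ;
  sym_rep : sym_car -> R -> R ;
  sym_measurable : forall v, measurable_fun (unitI R) (sym_rep v) ;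
  sym_linear : forall (a : R) (u v : sym_car),
    \forall s \ae (@lebesgue_measure R), unitI R s ->
      sym_rep (a *: u + v) s = a * sym_rep u s + sym_rep v s ;
  sym_inj : forall u v : sym_car,
    sym_rep u = sym_rep v %[ae (@lebesgue_measure R) in unitI R] -> u = v ;
  sym_nonzero : exists v : sym_car, v != 0 ;
  sym_ideal : forall (x : R -> R) (u : sym_car),
    measurable_fun (unitI R) x ->
    (\forall s \ae (@lebesgue_measure R),
       unitI R s -> `|x s| <= `|sym_rep u s|) ->
    exists2 v : sym_car,
      sym_rep v = x %[ae (@lebesgue_measure R) in unitI R] & `|v| <= `|u| ;
  sym_equimeasurable : forall (x : R -> R) (u : sym_car),
    measurable_fun (unitI R) x ->
    equimeasurable x (sym_rep u) ->
    exists2 v : sym_car,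
      sym_rep v = x %[ae (@lebesgue_measure R) in unitI R] & `|v| = `|u|
}.

Definition class_of (R : realType) (E : symmetric_space R) (x : R -> R) :
    set E :=
  [set v | sym_rep v = x %[ae (@lebesgue_measure R) in unitI R]].
Arguments class_of {R} E x _.

Definition in_sym (R : realType) (E : symmetric_space R) (x : R -> R) :=
  measurable_fun (unitI R) x /\ class_of E x !=set0.

(* The set contains at most one element, by sym_inj; the value is +oo when the
   class of x is not in E. *)
Definition sym_norm (R : realType) (E : symmetric_space R) (x : R -> R) :
    \bar R :=
  ereal_inf [set (`|v|)%:E | v in class_of E x].

Definition sym_unit_ball (R : realType) (E : symmetric_space R) :
    set (R -> R) :=
  [set y | in_sym E y /\ (sym_norm E y <= 1)%E].

Definition in_sym2 (R : realType) (E : symmetric_space R) (z : R * R -> R) :=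
  measurable_fun (unitI R `*` unitI R) z /\ in_sym E (rearrangement2 z).

Definition sym_norm2 (R : realType) (E : symmetric_space R)
    (z : R * R -> R) : \bar R :=
  sym_norm E (rearrangement2 z).

Definition tensor (R : realType) (x y : R -> R) : R * R -> R :=
  fun st => x st.1 * y st.2.

Definition in_multiplicator (R : realType) (E : symmetric_space R)
    (x : R -> R) :=
  measurable_fun (unitI R) x /\
  forall y, in_sym E y -> in_sym2 E (tensor x y).

Definition multiplicator_norm (R : realType) (E : symmetric_space R)
    (x : R -> R) : \bar R :=
  ereal_sup [set sym_norm2 E (tensor x y) | y in sym_unit_ball E].

Definition dilation (R : realType) (t : R) (y : R -> R) : R -> R :=
  fun u => y (u / t) * \1_(unitI R) (u / t).

Definition operator_norm (R : realType) (E : symmetric_space R)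
    (A : (R -> R) -> (R -> R)) : \bar R :=
  ereal_sup [set sym_norm E (A y) | y in sym_unit_ball E].

(* For 0 < t <= 1 the operator norm is finite (at most 1), so that taking its
   real part loses nothing. *)
Definition dilation_norm (R : realType) (E : symmetric_space R) (t : R) : R :=
  fine (operator_norm E (dilation t)).

(* The Lebesgue-Stieltjes measure of the library is defined for
   right-continuous non-decreasing functions on the whole line.  For psi
   positive and non-decreasing on ]0, 1], the following function is psi(s+) for
   0 <= s < 1 (hence psi(s) if psi is right-continuous at s > 0), psi(1) for
   s >= 1 and psi(0+) for s <= 0.  The absolute value is there only to make it
   cumulative for every psi. *)
Definition right_regularization (R : realType) (psi : R -> R) (s : R) : R :=
  inf [set `|psi (Num.min u 1)| | u in [set u | Num.max 0 s < u]].

Lemma right_regularization_has_inf (R : realType) (psi : R -> R) (s : R) :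
  has_inf [set `|psi (Num.min u 1)| | u in [set u | Num.max 0 s < u]].
Proof.
split; last by exists 0 => _ [u _ <-].
by exists `|psi (Num.min (Num.max 0 s + 1) 1)|, (Num.max 0 s + 1) => //=;
  rewrite ltrDl.
Qed.

Lemma right_regularization_le (R : realType) (psi : R -> R) (s u : R) :
  Num.max 0 s < u -> right_regularization psi s <= `|psi (Num.min u 1)|.
Proof.
move=> su; apply: ge_inf; last by exists u.
by case: (right_regularization_has_inf psi s).
Qed.

Lemma right_regularization_nondecreasing (R : realType) (psi : R -> R) :
  {homo right_regularization psi : s t / s <= t}.
Proof.
move=> s t st; apply: lb_le_inf.
  by case: (right_regularization_has_inf psi t).
move=> _ [u /= tu <-]; apply: right_regularization_le.
by rewrite (le_lt_trans _ tu)// ge_max !le_max lexx st orbT.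
Qed.

Lemma right_regularization_right_continuous (R : realType) (psi : R -> R) :
  right_continuous (right_regularization psi).
Proof.
move=> s; apply/cvgrPdist_lt => e e0.
have [_ [u /= su <-] ue] :=
  inf_adherent e0 (right_regularization_has_inf psi s).
have [u0 us] : 0 < u /\ s < u by move: su; rewrite gt_max => /andP[].
near=> t.
have st : s < t by near: t; exact: nbhs_right_gt.
have tu : t < u by near: t; exact: nbhs_right_lt.
rewrite distrC ger0_norm ?subr_ge0; last first.
  exact/right_regularization_nondecreasing/ltW.
rewrite ltrBlDl; apply: le_lt_trans ue.
by apply: right_regularization_le; rewrite gt_max u0.
Unshelve. all: by end_near. Qed.

HB.instance Definition _ (R : realType) (psi : R -> R) :=
  isCumulative.Build R _ R (right_regularization psi)
    (@right_regularization_nondecreasing R psi)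
    (@right_regularization_right_continuous R psi).

(* The second term is the contribution psi(0+) x^*(0+) of the jump of psi at
   0, where psi is set to 0; x^*(0+) may be +oo, and 0 * +oo = 0. *)
Definition lorentz_norm (R : realType) (psi x : R -> R) : \bar R :=
  (\int[lebesgue_stieltjes_measure (right_regularization psi)]_(s in `]0%R, 1%R])
     (rearrangement1 x s)%:E
   + (lim (psi s @[s --> 0^'+]))%:E
     * lim ((rearrangement1 x s)%:E @[s --> 0^'+]))%E.

Definition in_lorentz (R : realType) (psi x : R -> R) :=
  measurable_fun (unitI R) x /\ (lorentz_norm psi x < +oo)%E.

(* Main.v *)
(* Fix c > 0 and cut |x| at the levels c 2^j.  With t_0 = 1 and
   t_{j+1} = mu {|x| > c 2^j}, the shell c 2^(j-1) < |x| <= c 2^j has measure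
   t_j - t_{j+1}.  No measure-preserving map from I onto I x I is needed to view
   x (x) y as a function on I: since the shells are countably many, it suffices
   to put on each interval [t_{j+1}, t_j[ an affine copy of |y|, which gives a
   function Y on I.  Then x (x) y is dominated in distribution by any w that is
   above all the functions f_j = c 2^j Y 1_[0, t_j[, while f_j is dominated in
   distribution by the dilation by t_j of c 2^j y, so that
   ||f_j|| <= c 2^j psi(t_j) ||y||.  As E is complete, the sum of the f_j
   provides such a w in E, and a dyadic lower bound of the Lorentz norm yields
   sum_j ||f_j|| <= (c + 4 ||x||_Lambda(psi)) ||y||.  Finally let c tend to 0. *)
Require Import Defs.
From mathcomp Require Import all_boot all_order all_algebra.
From mathcomp Require Import all_classical all_reals all_analysis.
From mathcomp Require Import measurable_realfun lra ring.

Set Implicit Arguments.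
Unset Strict Implicit.
Unset Printing Implicit Defensive.

Import Order.TTheory GRing.Theory Num.Theory.
Import numFieldNormedType.Exports.

Local Open Scope classical_set_scope.
Local Open Scope ring_scope.

(** * The unit interval and superlevel sets *)

Lemma measurable_unitI (R : realType) : measurable (unitI R).
Proof. exact: measurable_itv. Qed.

Lemma lebesgue_measure_unitI (R : realType) : lebesgue_measure (unitI R) = 1%E.
Proof. by rewrite lebesgue_measure_itv/= lte_fin ltr01 oppr0 adde0. Qed.

Lemma lebesgue_measure_unitI_le1 (R : realType) :
  (lebesgue_measure (unitI R) <= 1)%E.
Proof. by rewrite lebesgue_measure_unitI. Qed.

Lemma lebesgue_measure_unitI_lty (R : realType) :
  (lebesgue_measure (unitI R) < +oo)%E.
Proof. by rewrite lebesgue_measure_unitI ltry. Qed.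

Lemma measurable_superlevel (R : realType) d (T : measurableType d)
    (D : set T) (z : T -> R) (tau : R) :
  measurable D -> measurable_fun D z -> measurable (D `&` [set w | tau < `|z w|]).
Proof.
move=> mD mz.
have -> : [set w | tau < `|z w|] = (Num.norm \o z) @^-1` `]tau, +oo[.
  by apply/seteqP; split => w /=; rewrite in_itv/= andbT.
by apply: (measurableT_comp (@normr_measurable R setT) mz).
Qed.

(** * Distribution functions and rearrangements *)

Section distribution.
Context (R : realType) d (T : measurableType d).
Variables (m : {measure set T -> \bar R}) (D : set T) (z : T -> R).
Hypotheses (mD : measurable D) (mz : measurable_fun D z).

Local Notation n := (distribution_function m D z).

Lemma le_distribution (s t : R) : s <= t -> (n t <= n s)%E.
Proof.
move=> st; apply: le_measure; rewrite ?inE; try exact: measurable_superlevel.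
by move=> w [Dw /= tw]; split => //=; exact: le_lt_trans tw.
Qed.

Lemma distribution_le_total (t : R) : (n t <= m D)%E.
Proof.
by apply: le_measure; rewrite ?inE//; exact: measurable_superlevel.
Qed.

(** This is right continuity of the distribution function: the superlevel set at [tau] is the
    increasing union of those at tau + 1/(k+1), so continuity from below applies. *)
Lemma distribution_right_lt (s : \bar R) (tau : R) :
  (s < n tau)%E -> exists2 t, tau < t & (s < n t)%E.
Proof.
move=> sn; apply: contrapT => /forall2NP H.
pose F k := D `&` [set w | tau + k.+1%:R^-1 < `|z w|].
have bF : \bigcup_k F k = D `&` [set w | tau < `|z w|].
  apply/seteqP; split => [w [k _ [Dw /= h]]|w [Dw /= h]].
    by split => //=; apply: le_lt_trans h; rewrite lerDl invr_ge0 ler0n.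
  have h0 : 0 < `|z w| - tau by rewrite subr_gt0.
  have [k _ kh] := near_infty_natSinv_lt (PosNum h0).
  exists k => //; split => //=; rewrite addrC -ltrBrDr.
  exact: (kh k (leqnn k)).
have mF k : measurable (F k) by exact: measurable_superlevel.
have ndF : nondecreasing_seq F.
  move=> i j ij; apply/subsetPset => w [Dw /= h]; split => //=.
  apply: le_lt_trans h; rewrite lerD2l lef_pV2 ?posrE ?ltr0n//.
  by rewrite ler_nat.
have := @nondecreasing_cvg_mu _ _ _ m F mF (bigcupT_measurable _ mF) ndF.
rewrite bF => cF; move: sn; apply/negP; rewrite -leNgt.
rewrite /distribution_function -(cvg_lim _ cF)//.
apply: lime_le; first by apply/cvg_ex; eexists; exact: cF.
apply: nearW => k; rewrite leNgt.
by have [|/negP] := H (tau + k.+1%:R^-1); rewrite // ltrDl invr_gt0 ltr0n.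
Qed.

Hypothesis finD : (m D < +oo)%E.

(** The superlevel sets at the levels k + 1 decrease to the empty set because [z] is real-valued,
    and [D] has finite measure, so continuity from above applies. For s > 0 it makes the infimum in
    [rearrangement] one of a nonempty set. *)
Lemma distribution_lt_ex (s : \bar R) :
  (0 < s)%E -> exists2 t, 0 < t & (n t < s)%E.
Proof.
move=> s0; apply: contrapT => /forall2NP H.
pose F k := D `&` [set w | k.+1%:R < `|z w|].
have mF k : measurable (F k) by exact: measurable_superlevel.
have bF : \bigcap_k F k = set0.
  rewrite -subset0 => w h.
  have [_ /=] := h (Num.bound `|z w|) Logic.I; apply/negP; rewrite -leNgt ltW//.
  by apply: (lt_trans (archi_boundP (normr_ge0 _))); rewrite ltr_nat.
have niF : nonincreasing_seq F.
  move=> i j ij; apply/subsetPset => w [Dw /= h]; split => //=.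
  by apply: le_lt_trans h; rewrite ler_nat.
have F0 : (m (F 0%N) < +oo)%E by exact: le_lt_trans (distribution_le_total _) _.
have := @nonincreasing_cvg_mu _ _ _ m F F0 mF (bigcapT_measurable mF) niF.
rewrite bF measure0 => cF; move: s0; apply/negP; rewrite -leNgt.
rewrite -(cvg_lim _ cF)//.
apply: lime_ge; first by apply/cvg_ex; eexists; exact: cF.
apply: nearW => k; rewrite leNgt.
by have [|/negP] := H (k.+1%:R); rewrite // ltr0n.
Qed.

Local Notation r := (rearrangement m D z).

Lemma rearrangement_ge0 s : 0 <= r s.
Proof.
rewrite /rearrangement; set A := [set _ | _].
have [A0|/nonemptyPn ->] := pselect (A !=set0); last by rewrite inf0.
by apply: lb_le_inf => // t [/ltW].
Qed.

Let has_inf_rearrangement s : 0 < s ->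
  has_inf [set tau | 0 < tau /\ (n tau < s%:E)%E].
Proof.
move=> s0; split; last by exists 0 => t [/ltW].
by have [t t0 ts] := @distribution_lt_ex s%:E s0; exists t.
Qed.

Lemma rearrangement_gt_distribution s tau :
  0 < tau -> tau < r s -> (s%:E <= n tau)%E.
Proof.
move=> tau0; apply: contraTT; rewrite -ltNge -leNgt => ns.
apply: ge_inf; last by [].
by exists 0 => t [/ltW].
Qed.

Lemma distribution_ge_rearrangement s tau :
  0 < s -> (s%:E <= n tau)%E -> tau <= r s.
Proof.
move=> s0 ns; apply: lb_le_inf; first by case: (has_inf_rearrangement s0).
move=> t [t0 nt]; rewrite leNgt; apply/negP => ttau.
by have := lt_le_trans nt (le_trans ns (le_distribution (ltW ttau))); rewrite ltxx.
Qed.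

(** Right continuity gives room to raise the level a little, which turns the weak inequality of
    [distribution_ge_rearrangement] into a strict one. *)
Lemma distribution_gt_rearrangement s tau :
  0 < s -> (s%:E < n tau)%E -> tau < r s.
Proof.
move=> s0 /distribution_right_lt[t taut /ltW nt].
exact: lt_le_trans taut (distribution_ge_rearrangement s0 nt).
Qed.

Lemma rearrangement_nonincreasing s t : 0 < s -> s <= t -> r t <= r s.
Proof.
move=> s0 st; apply: lb_le_inf; first by case: (has_inf_rearrangement s0).
move=> tau [tau0 ns]; apply: ge_inf; first by exists 0 => ? [/ltW].
by split => //; apply: lt_le_trans ns _; rewrite lee_fin.
Qed.

(** By monotonicity the superlevel sets within ]0, 1] are intervals. The point 0 is split off first,
    since the default value 0 taken there breaks monotonicity. *)
Lemma measurable_rearrangement : measurable_fun (unitI R) r.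
Proof.
apply/measurable_fun_itv_obnd_cbndP.
apply: (measurability _ (RGenOInfty.measurableE R)) => _ [_ [a ->] <-].
apply: is_interval_measurable => u v [/= u01 au] [/= v01 av] w /andP[uw wv].
move: au av u01 v01; rewrite /= !in_itv/= !andbT => au av /andP[u0 u1] /andP[v0 v1].
have w0 : 0 < w by exact: lt_le_trans u0 uw.
split; first by apply/andP; split; [|exact: le_trans v1].
by apply: lt_le_trans av _; exact: rearrangement_nonincreasing.
Qed.

(** With l the value of the distribution function at [tau], the set where the rearrangement exceeds
    [tau] lies between ]0, l[ and [0, l]. The bound on m D keeps ]0, l[ inside I. *)
Hypothesis D1 : (m D <= 1)%E.

Lemma distribution_rearrangement tau : 0 < tau ->
  distribution_function lebesgue_measure (unitI R) r tau = n tau.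
Proof.
move=> tau0; have := distribution_le_total tau => /le_trans/(_ D1).
have : (0 <= n tau)%E by exact: measure_ge0.
have hg := @rearrangement_gt_distribution ^~ tau.
have hd := @distribution_gt_rearrangement ^~ tau.
case: (n tau) hg hd => [l||]//= hg hd.
rewrite !lee_fin => l0 l1; apply/eqP; rewrite eq_le; apply/andP; split.
  apply: (@le_trans _ _ (lebesgue_measure (`[0, l] : set R))).
    apply: le_measure; rewrite ?inE; [|exact: measurable_itv|].
      apply: measurable_superlevel; first exact: measurable_unitI.
      exact: measurable_rearrangement.
    move=> s [/=]; rewrite /unitI/= !in_itv/= => /andP[s0 s1].
    rewrite ger0_norm ?rearrangement_ge0// => /(hg _ tau0).
    by rewrite lee_fin s0.
  rewrite lebesgue_measure_itv/= lte_fin.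
  by case: ltP; rewrite ?oppr0 ?adde0// lee_fin.
apply: (@le_trans _ _ (lebesgue_measure (`]0, l[ : set R))).
  rewrite lebesgue_measure_itv/= lte_fin.
  by case: ltP; rewrite ?oppr0 ?adde0// lee_fin.
apply: le_measure; rewrite ?inE; [exact: measurable_itv| |].
  apply: measurable_superlevel; first exact: measurable_unitI.
  exact: measurable_rearrangement.
move=> s /=; rewrite in_itv/= => /andP[s0 sl]; split.
  by rewrite /unitI/= in_itv/= (ltW s0) (le_trans (ltW sl)).
by rewrite /= ger0_norm ?rearrangement_ge0//; apply: hd.
Qed.

End distribution.

Lemma ae_le_measure d (T : measurableType d) (R : realType)
    (m : {measure set T -> \bar R}) (A B : set T) :
  measurable A -> measurable B -> (\forall s \ae m, A s -> B s) ->
  (m A <= m B)%E.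
Proof.
move=> mA mB [N [mN N0 AB]].
rewrite -(measureU0 mB mN N0); apply: le_measure; rewrite ?inE//.
  exact: measurableU.
move=> s As; have [Bs|nBs] := pselect (B s); [by left|right].
by apply: AB => /(_ As).
Qed.

(* filterS and filterS2, restated because their Filter instance is not always
   inferred for lebesgue_measure. *)
Lemma lebesgue_aeS (R : realType) (P Q : R -> Prop) :
  (forall s, P s -> Q s) -> (\forall s \ae (@lebesgue_measure R), P s) ->
  \forall s \ae (@lebesgue_measure R), Q s.
Proof. exact: (@filterS _ _ (ae_filter_ringOfSetsType (@lebesgue_measure R))). Qed.

Lemma lebesgue_aeS2 (R : realType) (P P' Q : R -> Prop) :
  (forall s, P s -> P' s -> Q s) -> (\forall s \ae (@lebesgue_measure R), P s) ->
  (\forall s \ae (@lebesgue_measure R), P' s) ->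
  \forall s \ae (@lebesgue_measure R), Q s.
Proof. exact: (@filterS2 _ _ (ae_filter_ringOfSetsType (@lebesgue_measure R))). Qed.

(** * Symmetric spaces *)

Section symmetric_space_theory.
Context (R : realType).
Local Notation mu := (@lebesgue_measure R).
Local Notation n := (distribution_function mu (unitI R)).
Implicit Types (E : symmetric_space R) (x y : R -> R).

Lemma ae_le_distribution x y (tau : R) :
  measurable_fun (unitI R) x -> measurable_fun (unitI R) y ->
  (\forall s \ae mu, unitI R s -> `|x s| <= `|y s|) -> (n x tau <= n y tau)%E.
Proof.
move=> mx my xy; apply: ae_le_measure.
- by apply: measurable_superlevel; [exact: measurable_unitI|].
- by apply: measurable_superlevel; [exact: measurable_unitI|].
- move: xy; apply: lebesgue_aeS => s xy [Is /= h]; split => //=.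
  exact: lt_le_trans h (xy Is).
Qed.

Lemma ae_eq_distribution x y (tau : R) :
  measurable_fun (unitI R) x -> measurable_fun (unitI R) y ->
  x = y %[ae mu in unitI R] -> n x tau = n y tau.
Proof.
move=> mx my xy; apply/eqP; rewrite eq_le; apply/andP; split.
  by apply: ae_le_distribution => //; move: xy; apply: lebesgue_aeS => s /[apply] ->.
by apply: ae_le_distribution => //; move: xy; apply: lebesgue_aeS => s /[apply] ->.
Qed.

Lemma rearrangement1_distribution x (tau : R) : measurable_fun (unitI R) x ->
  0 < tau -> n (rearrangement1 x) tau = n x tau.
Proof.
move=> mx; apply: distribution_rearrangement => //.
- exact: measurable_unitI.
- exact: lebesgue_measure_unitI_lty.
- exact: lebesgue_measure_unitI_le1.
Qed.

Lemma measurable_rearrangement1 x : measurable_fun (unitI R) x ->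
  measurable_fun (unitI R) (rearrangement1 x).
Proof.
move=> mx; apply: measurable_rearrangement => //.
- exact: measurable_unitI.
- exact: lebesgue_measure_unitI_lty.
Qed.

Lemma le_rearrangement1 x y s : measurable_fun (unitI R) x ->
  (forall tau, 0 < tau -> (n x tau <= n y tau)%E) ->
  measurable_fun (unitI R) y ->
  rearrangement1 x s <= rearrangement1 y s.
Proof.
move=> mx xy my; have [s0|s0] := ltP 0 s; last first.
  (* For s <= 0 no level qualifies, as measures are nonnegative, and both sides take the default
     value inf set0 = 0. *)
  suff h z : rearrangement1 z s = 0 by rewrite !h.
  rewrite /rearrangement1 /rearrangement.
  suff -> : [set tau | 0 < tau /\ (n z tau < s%:E)%E] = set0 by rewrite inf0.
  rewrite -subset0 => t [_ /= /lt_le_trans h].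
  have /h : (s%:E <= 0)%E by rewrite lee_fin.
  by rewrite ltNge measure_ge0.
apply: lb_le_inf.
  have [|||t t0 ts] := @distribution_lt_ex _ _ _ mu (unitI R) y _ my _ s%:E.
  - exact: measurable_unitI.
  - exact: lebesgue_measure_unitI_lty.
  - by rewrite lte_fin.
  - by exists t.
move=> tau [tau0 ns]; apply: ge_inf; first by exists 0 => ? [/ltW].
by split => //; apply: le_lt_trans ns; exact: xy.
Qed.

(* Passing through rearrangements turns an inequality between distribution
   functions into a pointwise one. *)
Lemma sym_domination E x (u : E) : measurable_fun (unitI R) x ->
  (forall tau, 0 < tau -> (n x tau <= n (sym_rep u) tau)%E) ->
  exists2 v : E, class_of E x v & `|v| <= `|u|.
Proof.
move=> mx xu; have mu_ := sym_measurable u.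
have [||w wu nw] := @sym_equimeasurable R E (rearrangement1 (sym_rep u)) u.
- exact: measurable_rearrangement1.
- by move=> tau tau0; exact: rearrangement1_distribution.
have [||w' w'x nw'] := @sym_ideal R E (rearrangement1 x) w.
- exact: measurable_rearrangement1.
- move: wu; apply: lebesgue_aeS => s /[apply] ->.
  rewrite !ger0_norm; [|exact: rearrangement_ge0..].
  exact: le_rearrangement1.
have [||v vx nv] := @sym_equimeasurable R E x w'.
- by [].
- move=> tau tau0; rewrite -(rearrangement1_distribution mx tau0).
  apply/esym/ae_eq_distribution => //; first exact: sym_measurable.
  exact: measurable_rearrangement1.
by exists v => //; rewrite nv -nw.
Qed.

Lemma class_of_inj E x (u v : E) : class_of E x u -> class_of E x v -> u = v.
Proof.
move=> ux vx; apply: sym_inj; apply: (ae_eq_trans ux); exact: ae_eq_sym.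
Qed.

Lemma sym_normE E x (v : E) : class_of E x v -> sym_norm E x = `|v|%:E.
Proof.
move=> vx; rewrite /sym_norm (_ : image _ _ = [set `|v|%:E]) ?ereal_inf1//.
apply/seteqP; split => [_ [w wx <-]|_ ->]; last by exists v.
by rewrite (class_of_inj wx vx).
Qed.

(** Linearity with both vectors zero and scalar 1 gives r = r + r almost everywhere for the
    representative r of 0. *)
Lemma sym_rep0 E : sym_rep (0 : E) = cst 0 %[ae mu in unitI R].
Proof.
move: (sym_linear 1 (0 : E) 0); apply: lebesgue_aeS => s /[apply].
by rewrite scale1r addr0 mul1r => /eqP; rewrite -subr_eq0 opprD addNKr oppr_eq0 => /eqP.
Qed.

Lemma sym_repZ E a (u : E) :
  sym_rep (a *: u) = (fun s => a * sym_rep u s) %[ae mu in unitI R].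
Proof.
move: (sym_linear a u 0) (sym_rep0 E); apply: lebesgue_aeS2.
move=> s /[swap] h0 /[swap] Is /(_ Is).
by rewrite (h0 Is) !addr0.
Qed.

Lemma sym_repD E (u v : E) :
  sym_rep (u + v) = (fun s => sym_rep u s + sym_rep v s) %[ae mu in unitI R].
Proof.
by move: (sym_linear 1 u v); apply: lebesgue_aeS => s /[apply]; rewrite scale1r mul1r.
Qed.

Lemma sym_repB E (u v : E) :
  sym_rep (u - v) = (fun s => sym_rep u s - sym_rep v s) %[ae mu in unitI R].
Proof.
move: (sym_linear (-1) v u); apply: lebesgue_aeS => s /[apply].
by rewrite scaleN1r mulN1r addrC => ->; rewrite addrC.
Qed.

(* The negative part of the limit v is dominated by |w k - v|. *)
Lemma sym_ge0_closed E (w : E ^nat) (v : E) :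
  (\forall k \near \oo, \forall s \ae mu, unitI R s -> 0 <= sym_rep (w k) s) ->
  w k @[k --> \oo] --> v ->
  \forall s \ae mu, unitI R s -> 0 <= sym_rep v s.
Proof.
move=> w0 wv; pose f s := Num.max 0 (- sym_rep v s).
have mf : measurable_fun (unitI R) f.
  apply: measurable_maxr; first exact: measurable_cst.
  by apply: measurableT_comp => //; exact: sym_measurable.
have bound (z : E) : (\forall s \ae mu, unitI R s -> 0 <= sym_rep z s) ->
    exists2 u : E, class_of E f u & `|u| <= `|z - v|.
  move=> z0; apply: sym_ideal => //.
  move: z0 (sym_repB z v); apply: lebesgue_aeS2 => s zs zv Is.
  rewrite (zv Is) /f; have := zs Is; move: (sym_rep z s) (sym_rep v s) => a b a0.
  rewrite ger0_norm ?le_max ?lexx// ge_max normr_ge0/=.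
  by apply: le_trans (ler_norm _); rewrite lerDr.
have [N _ wN] := w0.
have [u fu _] := bound _ (wN N (leqnn N)).
(* Every vector given by [bound] is the class of [f], so the norm of [u] is at most that of w k - v
   for all large k. *)
suff u0 : u = 0.
  rewrite u0 in fu; move: fu (sym_rep0 E); apply: lebesgue_aeS2 => s fs e0 Is.
  move: (fs Is); rewrite (e0 Is) /f/= => /esym/eqP.
  by rewrite eq_le ge_max lexx/= oppr_le0 => /andP[].
apply/eqP; rewrite -normr_le0; apply/ler_addgt0Pr => e e0; rewrite add0r.
have [M _ wM] : \forall k \near \oo, `|v - w k| < e by move/cvgrPdist_lt : wv; apply.
have [u' fu' u'w] := bound _ (wN (maxn N M) (leq_maxl _ _)).
rewrite (class_of_inj fu fu') (le_trans u'w)// distrC ltW//.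
exact: (wM _ (leq_maxr _ _)).
Qed.

End symmetric_space_theory.

(** * Dilations *)

(** The pushforward of Lebesgue measure under the affine map, divided by [l], agrees with Lebesgue
    measure on half-open intervals, and uniqueness extends this to all measurable sets. *)
Lemma lebesgue_measure_affine (R : realType) (a l : R) (A : set R) :
  0 < l -> measurable A ->
  lebesgue_measure ((fun s => (s - a) / l) @^-1` A) = (l%:E * lebesgue_measure A)%E.
Proof.
move=> l0 mA; pose f s : measurableTypeR R := (s - a) / l.
have mf : measurable_fun [set: measurableTypeR R] f.
  by apply: measurable_funM => //; apply: measurable_funB.
have li0 : 0 <= l^-1 by rewrite invr_ge0 ltW.
suff -> : lebesgue_measure A =
    mscale (NngNum li0) (pushforward (@lebesgue_measure R) f) A.
  rewrite /mscale/= muleA -EFinM divff ?mul1e// gt_eqF//.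
move=> mf'; apply: lebesgue_measure_unique => // _ [[u v]] _ <-.
transitivity ((l^-1)%:E * lebesgue_measure (f @^-1` `]u, v]%classic))%E; last by [].
have fE : f @^-1` `]u, v]%classic = `](u * l + a), (v * l + a)]%classic :> set R.
  apply/seteqP; split => s /=; rewrite !in_itv/= /f ltr_pdivlMr// ler_pdivrMr//.
    by rewrite ltrBrDr lerBlDr.
  by rewrite ltrBrDr lerBlDr.
rewrite fE !lebesgue_measure_itv/= !lte_fin ltrD2r ltr_pM2r//.
case: ifPn => uv; last by rewrite mule0.
rewrite -!EFinD -EFinM; congr EFin.
by field; rewrite gt_eqF.
Qed.

Lemma class_of_rep (R : realType) (E : symmetric_space R) (u : E) :
  class_of E (sym_rep u) u.
Proof. exact: aeW. Qed.

Section dilation_theory.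
Context (R : realType).
Local Notation mu := (@lebesgue_measure R).
Local Notation n := (distribution_function mu (unitI R)).
Implicit Types (E : symmetric_space R) (x y : R -> R).

Lemma dilation_restrict (t : R) y :
  dilation t y = (fun u => (y \_ (unitI R)) ((u - 0) / t)).
Proof.
apply/funext => u; rewrite /dilation subr0 patchE indicE.
by case: (boolP (u / t \in unitI R)); rewrite ?mulr1 ?mulr0.
Qed.

Lemma measurable_affine (a l : R) :
  measurable_fun [set: R] (fun s : R => (s - a) / l).
Proof. by apply: measurable_funM => //; apply: measurable_funB. Qed.

Lemma measurable_dilation (t : R) y :
  measurable_fun (unitI R) y -> measurable_fun (unitI R) (dilation t y).
Proof.
move=> my; apply: measurable_funTS; rewrite dilation_restrict.
apply: (measurableT_comp _ (measurable_affine 0 t)).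
exact: ((measurable_restrictT y (@measurable_unitI R)).1 my).
Qed.

(** As t <= 1, the stretched superlevel set stays inside [0, t] and no part of it is cut off by I;
    as tau >= 0, the points where the dilation is extended by 0 do not count. *)
Lemma distribution_dilation (t : R) y (tau : R) : 0 < t <= 1 -> 0 <= tau ->
  measurable_fun (unitI R) y -> n (dilation t y) tau = (t%:E * n y tau)%E.
Proof.
move=> /andP[t0 t1] tau0 my.
rewrite -(@lebesgue_measure_affine R 0 t)//; last first.
  by apply: measurable_superlevel; [exact: measurable_unitI|].
congr (lebesgue_measure _); rewrite dilation_restrict.
apply/seteqP; split => u /=.
  rewrite patchE; case: ifPn => [|_ [_]]; first by rewrite inE => Iu [].
  by rewrite normr0 ltNge tau0.
move=> [Iu h]; rewrite patchE mem_set//; split => //.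
move: Iu; rewrite /unitI/= !in_itv/= subr0 ler_pdivlMr// ler_pdivrMr// mul0r mul1r.
by move=> /andP[-> /le_trans]; exact.
Qed.

Lemma dilation_class E (t : R) y (u : E) : 0 < t <= 1 ->
  measurable_fun (unitI R) y -> class_of E y u ->
  exists2 v : E, class_of E (dilation t y) v & `|v| <= `|u|.
Proof.
move=> t01 my yu; apply: sym_domination; first exact: measurable_dilation.
move=> tau tau0; rewrite distribution_dilation ?(ltW tau0)//.
rewrite (ae_eq_distribution tau (sym_measurable u) my yu).
case/andP: t01 => t0 t1; rewrite -[leRHS]mul1e.
by apply: lee_wpmul2r => //; exact: measure_ge0.
Qed.

(** The zero vector keeps the supremum away from -oo, and dilations by t <= 1 are contractions,
    which bounds it by 1. *)
Lemma operator_norm_dilationE E (t : R) : 0 < t <= 1 ->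
  operator_norm E (dilation t) = (dilation_norm E t)%:E.
Proof.
move=> t01; rewrite /dilation_norm fineK// fin_real//; apply/andP; split.
  have [v vy _] := dilation_class t01 (sym_measurable (0 : E)) (class_of_rep 0).
  apply: (@lt_le_trans _ _ `|v|%:E); first by rewrite ltNyr.
  apply: ereal_sup_ubound; exists (sym_rep (0 : E)); last exact: sym_normE.
  split.
    by split; [exact: sym_measurable|exists 0; exact: class_of_rep].
  by rewrite (sym_normE (class_of_rep 0)) normr0 lee01.
apply: (@le_lt_trans _ _ 1%E); last by rewrite ltry.
apply: ge_ereal_sup => _ [y [[my [u yu]] y1] <-].
have [v vy vu] := dilation_class t01 my yu.
by rewrite (sym_normE vy) (le_trans _ y1)// (sym_normE yu) lee_fin.
Qed.

Lemma dilation_norm_ub E (t : R) y (u v : E) : 0 < t <= 1 ->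
  measurable_fun (unitI R) y -> class_of E y u -> class_of E (dilation t y) v ->
  `|u| <= 1 -> `|v| <= dilation_norm E t.
Proof.
move=> t01 my yu vy u1; rewrite -lee_fin -operator_norm_dilationE//.
apply: ereal_sup_ubound; exists y; last exact: sym_normE.
by split; [split => //; exists u|rewrite (sym_normE yu) lee_fin].
Qed.

Lemma dilation_norm_le1 E (t : R) : 0 < t <= 1 -> dilation_norm E t <= 1.
Proof.
move=> t01; rewrite -lee_fin -operator_norm_dilationE//.
apply: ge_ereal_sup => _ [y [[my [u yu]] y1] <-].
have [v vy vu] := dilation_class t01 my yu.
by rewrite (sym_normE vy) (le_trans _ y1)// (sym_normE yu) lee_fin.
Qed.

Lemma dilation_norm_ge0 E (t : R) : 0 < t <= 1 -> 0 <= dilation_norm E t.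
Proof.
move=> t01; have [v vy _] := dilation_class t01 (sym_measurable (0 : E)) (class_of_rep 0).
apply: le_trans (normr_ge0 v) _.
apply: (dilation_norm_ub t01 (sym_measurable (0 : E)) (class_of_rep 0) vy).
by rewrite normr0.
Qed.

(** The distribution function of the dilation by s is s n_y, which is below t n_y, so the smaller
    dilation is dominated by the larger one. *)
Lemma dilation_norm_homo E (s t : R) : 0 < s -> s <= t -> t <= 1 ->
  dilation_norm E s <= dilation_norm E t.
Proof.
move=> s0 st t1; have t0 := lt_le_trans s0 st; have s1 := le_trans st t1.
have s01 : 0 < s <= 1 by rewrite s0.
have t01 : 0 < t <= 1 by rewrite t0.
rewrite -lee_fin -operator_norm_dilationE//.
apply: ge_ereal_sup => _ [y [[my [u yu]] y1] <-].
have [v vy vu] := dilation_class t01 my yu.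
have [||w wy wv] := @sym_domination R E (dilation s y) v.
- exact: measurable_dilation.
- move=> tau tau0.
  rewrite (ae_eq_distribution tau (sym_measurable v) (measurable_dilation t my) vy).
  rewrite !distribution_dilation ?(ltW tau0)//.
  by apply: lee_wpmul2r; rewrite ?lee_fin//; exact: measure_ge0.
rewrite (sym_normE wy) lee_fin (le_trans wv)//.
by apply: (dilation_norm_ub t01 my yu vy); rewrite -lee_fin -(sym_normE yu).
Qed.

Lemma distributionZ (a : R) y (tau : R) : 0 < a ->
  n (fun s => a * y s) tau = n y (tau / a).
Proof.
move=> a0; congr (mu (_ `&` _)); apply/seteqP; split => s /=;
by rewrite normrM (gtr0_norm a0) ltr_pdivrMr// mulrC.
Qed.

(** The right-hand side t n_y is the distribution function of the dilation of [y] by [t], so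
    [sym_domination] applies. The operator norm only tests the unit ball, hence the division by the
    norm of [u] and the separate case u = 0. *)
Lemma sym_dilation_domination E (t : R) y x (u : E) : 0 < t <= 1 ->
  measurable_fun (unitI R) x -> measurable_fun (unitI R) y -> class_of E y u ->
  (forall tau, 0 < tau -> (n x tau <= t%:E * n y tau)%E) ->
  exists2 v : E, class_of E x v & `|v| <= dilation_norm E t * `|u|.
Proof.
move=> t01 mx my yu xy; have [u0|u0] := eqVneq u 0.
  have [|v vx] := @sym_domination R E x u mx; last first.
    by rewrite u0 normr0 mulr0 => v0; exists v.
  move=> tau tau0; rewrite (ae_eq_distribution tau (sym_measurable u) my yu).
  apply: le_trans (xy _ tau0) _.
  case/andP: t01 => t0 t1; rewrite -[leRHS]mul1e.
  by apply: lee_wpmul2r => //; exact: measure_ge0.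
have nu0 : 0 < `|u| by rewrite normr_gt0.
pose y' s := `|u|^-1 * y s; pose x' s := `|u|^-1 * x s.
have my' : measurable_fun (unitI R) y' by exact: measurable_funM.
have mx' : measurable_fun (unitI R) x' by exact: measurable_funM.
have yu' : class_of E y' (`|u|^-1 *: u).
  move: (sym_repZ `|u|^-1 u) yu; apply: lebesgue_aeS2.
  by move=> s /[swap] h /[swap] Is -> //; rewrite h.
have [v vy _] := dilation_class t01 my' yu'.
have nv : `|v| <= dilation_norm E t.
  apply: dilation_norm_ub yu' vy _ => //.
  by rewrite normrZ ger0_norm ?invr_ge0// mulVf// gt_eqF.
have [|w wx wv] := @sym_domination R E x' v mx'.
  move=> tau tau0.
  rewrite (ae_eq_distribution tau (sym_measurable v) (measurable_dilation t my') vy).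
  rewrite distribution_dilation ?(ltW tau0)//.
  by rewrite !distributionZ ?invr_gt0//; apply: xy; rewrite divr_gt0// invr_gt0.
exists (`|u| *: w).
  move: (sym_repZ `|u| w) wx; apply: lebesgue_aeS2 => s /[swap] h /[swap] Is -> //.
  by rewrite h// /x' mulrA divff ?mul1r// gt_eqF.
by rewrite normrZ normr_id mulrC ler_pM2r// (le_trans wv).
Qed.

End dilation_theory.

(** * Lower bounds of the Lorentz norm *)

Section lorentz_lower_bound.
Context (R : realType).
Variable psi : R -> R.
Hypothesis psi_ge0 : forall t, 0 < t <= 1 -> 0 <= psi t.
Hypothesis psi_homo : forall s t, 0 < s -> s <= t -> t <= 1 -> psi s <= psi t.
Local Notation nu := (lebesgue_stieltjes_measure (right_regularization psi)).

Lemma right_regularization_ge (t : R) : 0 < t <= 1 ->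
  psi t <= right_regularization psi t.
Proof.
move=> /andP[t0 t1]; apply: lb_le_inf.
  by case: (right_regularization_has_inf psi t).
move=> _ [u /= + <-]; rewrite gt_max => /andP[u0 tu].
apply: le_trans (ler_norm _); apply: psi_homo => //.
  by rewrite le_min t1 ltW.
by rewrite ge_min lexx orbT.
Qed.

(** The Stieltjes measure of ]0, T] subtracts the left-hand side; the bound shows that the jump term
    psi(0+) of the norm makes up for it. *)
Lemma right_regularization0_le :
  right_regularization psi 0 <= lim (psi s @[s --> 0^'+]).
Proof.
apply: limr_ge.
  apply: nondecreasing_at_right_is_cvgr.
    near=> z => s t; rewrite !in_itv/= => /andP[s0 sz] /andP[t0 tz] st.
    apply: psi_homo => //; apply: le_trans (ltW tz) _.
    by near: z; apply: nbhs_right_le.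
  near=> z; exists 0 => _ [s /= + <-]; rewrite in_itv/= => /andP[s0 sz].
  apply: psi_ge0; rewrite s0/= (le_trans (ltW sz))//.
  by near: z; apply: nbhs_right_le.
near=> s.
have s0 : 0 < s by near: s; exact: nbhs_right_gt.
have s1 : s <= 1 by near: s; exact: nbhs_right_le.
have := @right_regularization_le R psi 0 s; rewrite maxxx min_l// => /(_ s0).
by rewrite ger0_norm// psi_ge0// s0.
Unshelve. all: by end_near. Qed.

Lemma lebesgue_stieltjes_measure_itvoc (f : cumulative R R) (a b : R) : a <= b ->
  lebesgue_stieltjes_measure f `]a, b]%classic = (f b - f a)%:E.
Proof.
move=> ab; rewrite /lebesgue_stieltjes_measure /measure_extension.
rewrite measurable_mu_extE/=; last exact: is_ocitv.
by rewrite wlength_itv_bnd.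
Qed.

Variable x : R -> R.
Hypothesis mx : measurable_fun (unitI R) x.
Variables (N : nat) (a T : nat -> R).
Hypotheses (a_ge0 : forall j, 0 <= a j) (T01 : forall j, 0 <= T j <= 1).
Hypothesis aT : forall s : R, 0 < s <= 1 ->
  \sum_(j < N) a j * (s <= T j)%R%:R <= rearrangement1 x s.

(** Only finitely many j are involved, so one neighbourhood of 0 serves them all. *)
Let near0_T : \forall s \near 0^'+, forall j, (j < N)%N -> 0 < T j -> s <= T j.
Proof.
elim: N => [|k ih]; first by apply: nearW.
have [Tk|Tk] := ltP 0 (T k).
  near=> s => j; rewrite ltnS leq_eqVlt => /orP[/eqP -> _|jk Tj].
    by near: s; exact: nbhs_right_le.
  by move: j jk Tj; near: s.
near=> s => j; rewrite ltnS leq_eqVlt => /orP[/eqP ->|jk Tj].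
  by rewrite ltNge Tk.
by move: j jk Tj; near: s.
Unshelve. all: by end_near. Qed.

(** Close to 0 every step with T j > 0 is present in the step function below x^*; the limit exists
    because x^* is nonincreasing. *)
Let rearrangement1_0_ge :
  ((\sum_(j < N) a j * (0 < T j)%R%:R)%:E <=
    lim ((rearrangement1 x s)%:E @[s --> 0^'+]))%E.
Proof.
apply: lime_ge.
  apply: nonincreasing_at_right_is_cvge.
  near=> z => s t; rewrite !in_itv/= => /andP[s0 sz] /andP[t0 tz] st.
  rewrite lee_fin; apply: rearrangement_nonincreasing => //.
  - exact: measurable_unitI.
  - exact: lebesgue_measure_unitI_lty.
near=> s.
have s0 : 0 < s by near: s; exact: nbhs_right_gt.
have s1 : s <= 1 by near: s; exact: nbhs_right_le.
rewrite lee_fin; apply: le_trans (aT _); last by rewrite s0.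
apply: ler_sum => j _; apply: ler_wpM2l => //.
case: (ltP 0 (T j)) => // Tj; rewrite ler_nat lt0b.
by move: Tj; move: (ltn_ord j); move: (nat_of_ord j); near: s.
Unshelve. all: by end_near. Qed.

(** The step function below x^* is integrated term by term. With rr the right regularization, the
    step of height a j on ]0, T j] contributes a j (rr(T j) - rr(0)) to the integral and, if T j >
    0, a j psi(0+) to the jump term; as psi(0+) >= rr(0) and rr(T j) >= psi(T j), the total is at
    least a j psi(T j). *)
Lemma lorentz_norm_ge :
  ((\sum_(j < N) a j * (if 0 < T j then psi (T j) else 0))%:E <=
    lorentz_norm psi x)%E.
Proof.
pose rr := right_regularization psi.
have int_ge : ((\sum_(j < N) a j * (rr (T j) - rr 0))%:E <=
    \int[nu]_(s in `]0%R, 1%R]) (rearrangement1 x s)%:E)%E.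
  apply: (@le_trans _ _
    (\int[nu]_(s in `]0%R, 1%R]) (\sum_(j < N) (a j)%:E * (\1_(`]0, T j]) s)%:E)))%E.
    have mind (j : nat) : measurable_fun (`]0, 1]%classic : set R)
        (fun s : R => (\1_(`]0, T j]) s)%:E).
      by apply/measurable_EFinP; exact: measurable_indic.
    rewrite ge0_integral_sum//; last 2 first.
    - by move=> j; apply: measurable_funeM; exact: mind.
    - by move=> j s _; rewrite mule_ge0// lee_fin.
    rewrite -sumEFin; apply: lee_sum => j _.
    rewrite ge0_integralZl ?lee_fin//; last exact: mind.
    rewrite integral_indic// setIidl; last first.
      move=> s /=; rewrite !in_itv/= => /andP[-> /le_trans]; apply.
      by case/andP: (T01 j).
    rewrite EFinM -lebesgue_stieltjes_measure_itvoc; first exact: lexx.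
    by case/andP: (T01 j).
  apply: ge0_le_integral => //.
  - move=> s _; apply: sume_ge0 => j _; rewrite mule_ge0// lee_fin//.
  - apply: emeasurable_sum => j; apply: measurable_funeM.
    by apply/measurable_EFinP; exact: measurable_indic.
  - apply/measurable_EFinP.
    apply: measurable_funS (measurable_rearrangement1 mx) => //.
      exact: measurable_unitI.
    by move=> s /=; rewrite /unitI/= !in_itv/= => /andP[/ltW -> ->].
  move=> s /=; rewrite in_itv/= => s01; rewrite sumEFin lee_fin; apply: le_trans (aT s01).
  apply: ler_sum => j _; apply: ler_wpM2l => //.
  by rewrite indicE; case: (boolP (s \in _)) => //; rewrite inE/= in_itv/= => /andP[_ ->].
have psi0 := right_regularization0_le.
have rr0 : 0 <= rr 0.
  by apply: lb_le_inf; [case: (right_regularization_has_inf psi 0)|move=> _ [u _ <-]].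
set psi0' := lim _ in psi0.
have : ((\sum_(j < N) a j * (rr (T j) - rr 0))%:E +
   (psi0')%:E * (\sum_(j < N) a j * (0 < T j)%R%:R)%:E <= lorentz_norm psi x)%E.
  rewrite /lorentz_norm; apply: leeD => //; apply: lee_wpmul2l => //.
  by rewrite lee_fin (le_trans rr0).
apply: le_trans; rewrite -EFinM -EFinD lee_fin mulr_sumr -big_split/=.
apply: ler_sum => j _.
rewrite mulrCA -mulrDr; apply: ler_wpM2l => //.
case: ifPn => Tj.
  apply: le_trans (right_regularization_ge _) _.
    by case/andP: (T01 j) => _ ->; rewrite Tj.
  by rewrite mulr1 -/rr -addrA lerDl addrC subr_ge0.
rewrite mulr0 addr0 subr_ge0; apply: right_regularization_nondecreasing.
by case/andP: (T01 j).
Qed.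

End lorentz_lower_bound.

Lemma fine_distribution_itv (R : realType) (x : R -> R) (tau : R) :
  measurable_fun (unitI R) x ->
  distribution_function lebesgue_measure (unitI R) x tau =
    (fine (distribution_function lebesgue_measure (unitI R) x tau))%:E /\
  0 <= fine (distribution_function lebesgue_measure (unitI R) x tau) <= 1.
Proof.
move=> mx; set n := distribution_function _ _ _ _.
have n0 : (0 <= n)%E by exact: measure_ge0.
have n1 : (n <= 1)%E.
  apply: (le_trans _ (@lebesgue_measure_unitI_le1 R)).
  by apply: distribution_le_total => //; exact: measurable_unitI.
by move: n0 n1; case: n => //= r; rewrite !lee_fin => -> ->.
Qed.

(* If k is the last index with s <= n_x (c 2^k), the sum is at most the
   geometric sum up to k, which is bounded by c 2^k <= x^* s. *)
Lemma dyadic_rearrangement_ge (R : realType) (x : R -> R) (c s : R) (N : nat) :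
  measurable_fun (unitI R) x -> 0 < c -> 0 < s ->
  \sum_(j < N) (c * 2 ^+ j / 2) *
    (s <= fine (distribution_function lebesgue_measure (unitI R) x (c * 2 ^+ j)))%R%:R
  <= rearrangement1 x s.
Proof.
move=> mx c0 s0; elim: N => [|N ih]; first by rewrite big_ord0 rearrangement_ge0.
have [sN|sN] := leP s (fine
  (distribution_function lebesgue_measure (unitI R) x (c * 2 ^+ N))); last first.
  by rewrite big_ord_recr/= (leNgt s) sN mulr0 addr0.
have [nE _] := fine_distribution_itv (c * 2 ^+ N) mx.
apply: (@le_trans _ _ (c * 2 ^+ N)); last first.
  apply: distribution_ge_rearrangement => //; first exact: measurable_unitI.
    exact: lebesgue_measure_unitI_lty.
  by rewrite nE lee_fin.
apply: (@le_trans _ _ (\sum_(j < N.+1) (c * 2 ^+ j / 2))).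
  apply: ler_sum => j _; rewrite ler_piMr//; last by case: (s <= _).
  by rewrite divr_ge0// mulr_ge0 ?exprn_ge0// ltW.
elim: N {ih sN nE} => [|N ih]; first by rewrite big_ord_recr big_ord0/= add0r expr0; lra.
rewrite big_ord_recr/=; apply: le_trans (lerD ih (lexx _)) _.
by rewrite exprS; have := exprn_ge0 N (ler0n R 2); nra.
Qed.

(** * Tensor products *)

(** The index of the piece containing a point is chosen, and disjointness makes it unique.
    Measurability is checked on the countable partition formed by the pieces and the complement of
    their union. *)
Lemma measurable_glue (R : realType) (B : nat -> set R) (g : nat -> R -> R) :
  (forall j, measurable (B j)) -> trivIset setT B ->
  (forall j, measurable_fun setT (g j)) ->
  exists2 Y : R -> R, measurable_fun setT Y &
    (forall j s, B j s -> Y s = g j s) /\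
    (forall s, ~ (exists j, B j s) -> Y s = 0).
Proof.
move=> mB tB mg.
pose Y s := if pselect (exists j, B j s) is left H then g (sval (cid H)) s else 0.
have YB j s : B j s -> Y s = g j s.
  move=> Bs; rewrite /Y; case: pselect => [H|[]]; last by exists j.
  case: (cid H) => i/= Bi; suff -> : i = j by [].
  by apply: contrapT => /eqP ij; move/trivIsetP : tB => /(_ i j Logic.I Logic.I ij);
    apply/eqP/set0P; exists s.
have Y0 s : ~ (exists j, B j s) -> Y s = 0 by move=> H; rewrite /Y; case: pselect.
exists Y => //.
pose C k := if k is i.+1 then B i else ~` \bigcup_i B i.
have -> : [set: R] = \bigcup_k C k.
  apply/esym; rewrite -subTset => s _; have [[j Bs]|H] := pselect (exists j, B j s).
    by exists j.+1.
  by exists 0%N => // -[j _ Bs]; apply: H; exists j.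
apply/measurable_fun_bigcup => -[|i] //=.
    by apply: measurableC; exact: bigcupT_measurable.
  apply: (eq_measurable_fun (cst 0 : R -> R)); last exact: measurable_cst.
  move=> s; rewrite inE/= => H; rewrite Y0// => -[j Bs]; apply: H.
  by exists j.
apply: (eq_measurable_fun (g i)); last exact: measurable_funTS.
by move=> s; rewrite inE => /YB.
Qed.

(** The affine map carries [a, b[ onto [0, 1[, so of S at most the null set {1} is lost. If a = b,
    both sides vanish. *)
Lemma lebesgue_measure_affine_itv (R : realType) (a b : R) (S : set R) :
  a <= b -> measurable S -> S `<=` unitI R ->
  lebesgue_measure (`[a, b[%classic `&` (fun s => (s - a) / (b - a)) @^-1` S) =
  ((b - a)%:E * lebesgue_measure S)%E.
Proof.
rewrite le_eqVlt => /predU1P[<- _ _|ab mS SI].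
  by rewrite set_itvco0 set0I measure0 subrr mul0e.
have ba : 0 < b - a by rewrite subr_gt0.
have -> : `[a, b[%classic `&` (fun s => (s - a) / (b - a)) @^-1` S =
    (fun s => (s - a) / (b - a)) @^-1` (S `&` `[0, 1[%classic).
  have E (s : R) : s \in `[a, b[ = ((s - a) / (b - a) \in `[0, 1[).
    rewrite !in_itv/= ler_pdivlMr// ltr_pdivrMr// mul0r mul1r subr_ge0.
    by rewrite ltrD2r.
  apply/seteqP; split => s /=; first by rewrite E => -[].
  by move=> [? ?]; split => //; rewrite E.
rewrite lebesgue_measure_affine//; last exact: measurableI.
congr (_ * _)%E; apply/eqP; rewrite eq_le; apply/andP; split.
  by apply: le_measure; rewrite ?inE//; exact: measurableI.
apply: (@le_trans _ _ (lebesgue_measure ((S `&` `[0, 1[) `|` [set 1]))).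
  apply: le_measure; rewrite ?inE//.
    by apply: measurableU => //; exact: measurableI.
  move=> s Ss; have := SI _ Ss; rewrite /unitI/= in_itv/= => /andP[s0].
  rewrite le_eqVlt => /predU1P[->|s1]; [by right|left; split => //=].
  by rewrite in_itv/= s0.
rewrite measureU0//; first exact: measurableI.
exact: lebesgue_measure_set1.
Qed.

(** The partial sums telescope to (t 0 - t N) K. *)
Lemma nneseries_telescope_le (R : realType) (t : nat -> R) (K : R) :
  (forall j, t j.+1 <= t j) -> (forall j, 0 <= t j) -> 0 <= K ->
  (\sum_(0 <= i <oo) ((t i - t i.+1)%:E * K%:E) <= (t 0%N * K)%:E)%E.
Proof.
move=> tS t0 K0; apply: lime_le.
  by apply: is_cvg_nneseries => i _ _; rewrite -EFinM lee_fin mulr_ge0// subr_ge0.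
apply: nearW => N; rewrite (eq_bigr (fun i => ((t i - t i.+1) * K)%:E)).
  2: by move=> i _; rewrite EFinM.
rewrite sumEFin lee_fin -mulr_suml ler_wpM2r//.
rewrite (eq_bigr (fun i => - (t i.+1 - t i))); last by move=> i _; rewrite opprB.
by rewrite sumrN telescope_sumr// opprB gerBl.
Qed.

Lemma measurable_tensor (R : realType) (A B : set R) (x y : R -> R) :
  measurable A -> measurable B -> measurable_fun A x -> measurable_fun B y ->
  measurable_fun (A `*` B) (tensor x y).
Proof.
move=> mA mB mx my; apply: measurable_funM.
  apply: (measurable_comp mA _ mx) => [_ [s [As _] <-]//|].
  by apply: measurable_funTS; exact: measurable_fst.
apply: (measurable_comp mB _ my) => [_ [s [_ Bs] <-]//|].
by apply: measurable_funTS; exact: measurable_snd.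
Qed.

Section tensor_domination.
Context (R : realType).
Local Notation mu := (@lebesgue_measure R).
Local Notation n := (distribution_function mu (unitI R)).
Variables (x y : R -> R) (lv t : nat -> R) (D : nat -> set R).
Hypotheses (mx : measurable_fun (unitI R) x) (my : measurable_fun (unitI R) y).
Hypotheses (t0_le1 : t 0%N <= 1) (lv_gt0 : forall j, 0 < lv j).
Hypothesis t_ge0 : forall j, 0 <= t j.
Hypotheses (t_S : forall j, t j.+1 <= t j).
Hypotheses (mD : forall j, measurable (D j)).
Hypothesis muD : forall j, mu (D j) = (t j - t j.+1)%:E.
Hypotheses (ID : unitI R `<=` \bigcup_j D j).
Hypotheses (xD : forall j s, D j s -> `|x s| <= lv j).

(* B j is the copy of the shell D j in I, and aff j maps it onto [0, 1[. *)
Let B j : set R := `[t j.+1, t j[%classic.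
Let aff j (s : R) := (s - t j.+1) / (t j - t j.+1).
(** Extending by 0 outside I gives a function measurable on the whole line, which can be composed
    with every [aff j]. *)
Let yI := (fun s => `|y s|) \_ (unitI R).
Let K (tau : R) := unitI R `&` [set s | tau < `|y s|].
(** This is the copy inside [B j] of the superlevel set of |y|. *)
Let G j (tau : R) := B j `&` aff j @^-1` K tau.

Let t_le i j : (i <= j)%N -> t j <= t i.
Proof. by move: i j; apply/nonincreasing_seqP. Qed.

Let mB j : measurable (B j). Proof. exact: measurable_itv. Qed.

Let tB : trivIset setT B.
Proof.
have H i j : (i < j)%N -> B i `&` B j = set0.
  move=> ij; rewrite -subset0 => s [/=]; rewrite /B/= !in_itv/=.
  move=> /andP[si _] /andP[_ sj].
  by have := lt_le_trans sj (le_trans (t_le ij) si); rewrite ltxx.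
apply/trivIsetP => i j _ _; rewrite neq_ltn => /orP[|] ij; first exact: H.
by rewrite setIC H.
Qed.

Let myI : measurable_fun setT yI.
Proof.
apply: ((measurable_restrictT _ (@measurable_unitI R)).1).
exact: (measurableT_comp (@normr_measurable R setT) my).
Qed.

Let yI_ge0 s : 0 <= yI s.
Proof. by rewrite /yI patchE; case: ifP. Qed.

Let yIP (sigma s : R) : 0 < sigma -> sigma < yI s <-> K sigma s.
Proof.
move=> s0; rewrite /yI /K patchE; case: (boolP (s \in unitI R)).
  by rewrite inE => Is; split => [|[]//]; split.
rewrite notin_setE => nIs; split => [/lt_trans/(_ s0)|[/nIs//]].
by rewrite ltxx.
Qed.

Let mK (tau : R) : measurable (K tau).
Proof. by apply: measurable_superlevel; [exact: measurable_unitI|]. Qed.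

Let maff j : measurable_fun setT (aff j).
Proof. exact: measurable_affine. Qed.

Let mG j (tau : R) : measurable (G j tau).
Proof.
apply: measurableI => //; rewrite -[X in measurable X]setTI.
by apply: maff => //.
Qed.

Let muG j (tau : R) : mu (G j tau) = ((t j - t j.+1)%:E * n y tau)%E.
Proof. by apply: lebesgue_measure_affine_itv => // s []. Qed.

Lemma tensor_domination : exists f : nat -> R -> R,
  [/\ forall j, measurable_fun (unitI R) (f j),
      forall j s, 0 <= f j s,
      forall j (tau : R), 0 < tau -> (n (f j) tau <= (t j)%:E * n y (tau / lv j))%E &
      forall w : R -> R, measurable_fun (unitI R) w ->
        (forall j, \forall s \ae mu, unitI R s -> f j s <= `|w s|) ->
        forall tau : R, 0 < tau ->
        (distribution_function (mu \x mu)%E (unitI R `*` unitI R) (tensor x y) tau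
          <= n w tau)%E].
Proof.
have [|Y mY [YB Y0]] := measurable_glue mB tB (g := fun j s => yI (aff j s)).
  by move=> j; exact: (measurableT_comp myI (maff j)).
have Y_ge0 s : 0 <= Y s.
  have [[j Bs]|H] := pselect (exists j, B j s); first by rewrite (YB j).
  by rewrite Y0.
pose f j s := lv j * (Y s * \1_(`[0, t j[%classic) s).
have mf j : measurable_fun (unitI R) (f j).
  apply: measurable_funTS; apply: measurable_funM => //.
  by apply: measurable_funM => //; exact: measurable_indic.
have f_ge0 j s : 0 <= f j s by apply: mulr_ge0; [exact: ltW|exact: mulr_ge0].
exists f; split => //.
- move=> j tau tau0; set sg := tau / lv j.
  have sg0 : 0 < sg by rewrite divr_gt0.
  have [nE /andP[n0 _]] := fine_distribution_itv sg my.
  have mt i : mu (G (j + i) sg) = ((t (j + i) - t (j + i).+1)%:E * (fine (n y sg))%:E)%E.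
    by rewrite muG -nE.
  rewrite nE -EFinM.
  have := @nneseries_telescope_le R (fun i => t (j + i)) (fine (n y sg)).
  rewrite addn0 => h; apply: le_trans (h _ _ _) => //; last first.
    by move=> i; rewrite addnS.
  (* Below t j only the pieces [B k] with k >= j occur, and [Y] vanishes off the pieces, so the sets
     [G (j + i) sg] cover the superlevel set of [f j]. *)
  apply: (@le_trans _ _ (\sum_(0 <= i <oo) mu (G (j + i) sg))%E).
    apply: measure_sigma_subadditive.
    - by move=> i; exact: mG.
    - by apply: measurable_superlevel; [exact: measurable_unitI|exact: mf].
    move=> s [Is /=]; rewrite ger0_norm// /f indicE.
    case: (boolP (s \in _)); last by rewrite mulr0 mulr0 ltNge ltW.
    rewrite inE/= in_itv/= => /andP[s0 sj]; rewrite mulr1 mulrC -ltr_pdivrMr// -/sg => sY.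
    have [[k Bs]|H] := pselect (exists j, B j s); last first.
      by move: sY; rewrite Y0// ltNge ltW.
    have jk : (j <= k)%N.
      rewrite leqNgt; apply/negP => kj; move: Bs; rewrite /B/= in_itv/= => /andP[ks _].
      by have := lt_le_trans sj (le_trans (t_le kj) ks); rewrite ltxx.
    exists (k - j)%N => //; rewrite subnKC//; split => //=.
    by apply/yIP => //; rewrite -YB.
  by rewrite (eq_eseriesr (fun i _ => mt i)); under eq_eseriesr do rewrite -addnS.
- move=> w mw fw tau tau0.
  pose sg j := tau / lv j.
  have sg0 j : 0 < sg j by rewrite divr_gt0.
  have mI2 : measurable (unitI R `*` unitI R).
    by apply: measurableX; exact: measurable_unitI.
  (* On [D j] the factor |x| is at most lv j, so a product above [tau] forces |y| above tau / lv
     j. *)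
  apply: (@le_trans _ _ (\sum_(0 <= j <oo) (mu \x mu)%E (D j `*` K (sg j)))%E).
    apply: (measure_sigma_subadditive (mu \x mu)%E).
    - by move=> j; apply: measurableX; [exact: mD|exact: mK].
    - apply: measurable_superlevel; first exact: mI2.
      by apply: measurable_tensor => //; exact: measurable_unitI.
    - move=> [s u] [[/= Is Iu]]; rewrite /tensor/= normrM => h.
      have [j _ Ds] := ID Is; exists j => //; split => //; split => //=.
      rewrite /sg ltr_pdivrMr//; apply: lt_le_trans h _.
      by rewrite mulrC ler_wpM2l// xD.
  (* Each rectangle is traded for a subset of I of the same measure; these subsets are disjoint, so
     their measures add up to that of the union. *)
  apply: (@le_trans _ _ (\sum_(0 <= j <oo) mu (G j (sg j)))%E).
    apply: lee_nneseries => [|j _]; first by [].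
    rewrite muG -muD product_measure1E; [exact: lexx|exact: mD|exact: mK].
  apply: (@le_trans _ _ (mu (\bigcup_j G j (sg j)))).
    apply: content_ring_sup_sigma_additive => [i| |]; first exact: mG.
      by apply: bigcupT_measurable => i; exact: mG.
    apply/trivIsetP => i j _ _ ij; rewrite -subset0 => s [[Bi _] [Bj _]].
    by move/trivIsetP : tB => /(_ i j Logic.I Logic.I ij) <-; split; [exact: Bi|].
  apply: ae_le_measure.
  - by apply: bigcupT_measurable => i; exact: mG.
  - by apply: measurable_superlevel; [exact: measurable_unitI|].
  (* The countably many exceptional null sets merge into one. Outside it, a point of [G j (sg j)]
     has f j > tau and hence |w| > tau. *)
  have := ae_foralln fw; apply: lebesgue_aeS => s fws [j _ [Bs Ks]].
  move: (Bs); rewrite /B/= in_itv/= => /andP[ts st].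
  have s0 : 0 <= s := le_trans (t_ge0 _) ts.
  have Is : unitI R s.
    by rewrite /unitI/= in_itv/= s0 (le_trans (ltW st))// (le_trans (t_le (leq0n j))).
  split => //=; apply: lt_le_trans (fws j Is).
  rewrite /f indicE mem_set/=; last by rewrite in_itv/= s0.
  by rewrite mulr1 mulrC -ltr_pdivrMr// (YB j)//; apply/(yIP _ (sg0 j)).
Qed.

End tensor_domination.

(** * Majorants in the space and bounds for the multiplicator *)

Section multiplicator.
Context (R : realType).
Local Notation mu := (@lebesgue_measure R).
Local Notation n := (distribution_function mu (unitI R)).
Implicit Types (E : symmetric_space R) (x y : R -> R).

(** Completeness makes the absolutely convergent series converge. The limit minus v j is the limit
    of the partial sums without the term j; these are nonnegative, and [sym_ge0_closed] passes this
    on. *)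
Lemma sym_series E (v : E ^nat) (M : R) :
  (forall j, \forall s \ae mu, unitI R s -> 0 <= sym_rep (v j) s) ->
  (forall N, \sum_(j < N) `|v j| <= M) ->
  exists2 w : E, `|w| <= M &
    forall j, \forall s \ae mu, unitI R s -> sym_rep (v j) s <= sym_rep w s.
Proof.
move=> v0 vM.
(* The predicate [P] serves to leave out one term of the sum. *)
have sumv (P : pred nat) N :
    \forall s \ae mu, unitI R s -> 0 <= sym_rep (\sum_(i < N | P i) v i) s.
  apply: (big_ind (fun u : E => \forall s \ae mu, unitI R s -> 0 <= sym_rep u s)) => //.
    by move: (sym_rep0 E); apply: lebesgue_aeS => s /[apply] ->.
  move=> a b a0 b0.
  have ab : \forall s \ae mu, (unitI R s -> 0 <= sym_rep a s) /\
      (unitI R s -> 0 <= sym_rep b s).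
    by move: a0 b0; apply: lebesgue_aeS2.
  move: (sym_repD a b) ab; apply: lebesgue_aeS2 => s h [ha hb] Is.
  by rewrite (h Is) addr_ge0 ?ha ?hb.
have cv : cvgn (series v).
  apply: normed_cvg; apply: nondecreasing_is_cvgn.
    by apply: nondecreasing_series => i _ _ /=.
  exists M => _ [N _ <-]; have := vM N.
  by rewrite -(big_mkord xpredT (fun j => `|v j|)).
exists (limn (series v)).
  have cn : `|series v k| @[k --> \oo] --> `|limn (series v)|.
    by apply: cvg_norm; exact: cv.
  rewrite -(cvg_lim _ cn)//; apply: limr_le; first by apply/cvg_ex; eexists; exact: cn.
  apply: nearW => k; rewrite /series/= big_mkord.
  exact: le_trans (ler_norm_sum _ _ _) (vM k).
move=> j; have cj : series v k - v j @[k --> \oo] --> limn (series v) - v j.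
  by apply: cvgB => //; exact: cvg_cst.
have h0 : \forall s \ae mu, unitI R s -> 0 <= sym_rep (limn (series v) - v j) s.
  apply: sym_ge0_closed cj; exists j.+1 => // k /= jk.
  rewrite /series/= big_mkord (bigD1 (Ordinal jk))//= addrAC subrr add0r.
  exact: (sumv (fun i => i != j)).
move: (sym_repB (limn (series v)) (v j)) h0; apply: lebesgue_aeS2 => s h hs Is.
by have := hs Is; rewrite (h Is) subr_ge0.
Qed.

Lemma rearrangement2_tensor x y :
  measurable_fun (unitI R) x -> measurable_fun (unitI R) y ->
  measurable_fun (unitI R) (rearrangement2 (tensor x y)) /\
  forall tau : R, 0 < tau -> n (rearrangement2 (tensor x y)) tau =
   distribution_function (mu \x mu)%E (unitI R `*` unitI R) (tensor x y) tau.
Proof.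
move=> mx my.
have mI2 : measurable (unitI R `*` unitI R).
  by apply: measurableX; exact: measurable_unitI.
have mT : measurable_fun (unitI R `*` unitI R) (tensor x y).
  by apply: measurable_tensor => //; exact: measurable_unitI.
have I2 : ((mu \x mu)%E (unitI R `*` unitI R) <= 1)%E.
  rewrite product_measure1E; [|exact: measurable_unitI..].
  by have := lebesgue_measure_unitI R => /= ->; rewrite mule1.
have I2_lty := le_lt_trans I2 (ltry 1).
split; first exact: measurable_rearrangement.
by move=> tau tau0; exact: distribution_rearrangement.
Qed.


(** Starting from the whole of I at index 0 makes the first shell consist of all points where |x| <=
    c. *)
Let shell_time x (c : R) j : R := if j is i.+1 then fine (n x (c * 2 ^+ i)) else 1.

Let shell_super x (c : R) j : set R :=
  if j is i.+1 then unitI R `&` [set s | c * 2 ^+ i < `|x s|] else unitI R.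

Let shell x c j := shell_super x c j `\` shell_super x c j.+1.

Let shell_superP x c j : measurable_fun (unitI R) x ->
  [/\ measurable (shell_super x c j),
     mu (shell_super x c j) = (shell_time x c j)%:E & 0 <= shell_time x c j <= 1].
Proof.
move=> mx; case: j => [|j] /=.
  by split; [exact: measurable_unitI|exact: lebesgue_measure_unitI|rewrite lexx ler01].
have [nE n01] := fine_distribution_itv (c * 2 ^+ j) mx.
by split => //; apply: measurable_superlevel => //; exact: measurable_unitI.
Qed.

Let shell_superS x c j : 0 < c -> shell_super x c j.+1 `<=` shell_super x c j.
Proof.
move=> c0; case: j => [|j] s [Is /= h]; first by [].
split => //=; apply: le_lt_trans h; rewrite ler_pM2l// exprS.
by rewrite ler_peMl ?exprn_ge0// ler1n.
Qed.

Let shellP x c j : 0 < c -> measurable_fun (unitI R) x ->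
  [/\ measurable (shell x c j),
     mu (shell x c j) = (shell_time x c j - shell_time x c j.+1)%:E &
     shell_time x c j.+1 <= shell_time x c j].
Proof.
move=> c0 mx.
have [m1 e1 b1] := shell_superP c j mx; have [m2 e2 b2] := shell_superP c j.+1 mx.
split; first exact: measurableD.
  rewrite measureD//; last by rewrite [ltLHS]e1 ltry.
  rewrite setIidr; last exact: shell_superS.
  by rewrite EFinB -e1 -e2.
by rewrite -lee_fin -e1 -e2; apply: le_measure; rewrite ?inE//; exact: shell_superS.
Qed.

(** A point lies in the shell of the least j with |x s| <= c 2^j, which exists because 2^k > k. *)
Let shell_cover x c : 0 < c -> unitI R `<=` \bigcup_j shell x c j.
Proof.
move=> c0 s Is.
have H : exists j, `|x s| <= c * 2 ^+ j.
  exists (Num.bound (`|x s| / c)); rewrite mulrC -ler_pdivrMr// ltW//.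
  apply: (lt_le_trans (archi_boundP _)); first by rewrite divr_ge0// ltW.
  by rewrite -natrX ler_nat ltnW// ltn_expl.
case: (ex_minnP H) => j xj jmin; exists j => //; split.
  case: j xj jmin => //= j xj jmin; split => //=.
  by rewrite ltNge; apply/negP => /jmin; rewrite ltnn.
by case => _ /=; rewrite ltNge xj.
Qed.

Let shell_le x c j s : 0 < c -> shell x c j s -> `|x s| <= c * 2 ^+ j.
Proof.
move=> c0 [As nAs]; rewrite leNgt; apply/negP => h; apply: nAs; split => //.
by case: j As {h} => // j [].
Qed.

(* The summand c accounts for the set where |x| <= c. *)
Lemma tensor_bound E x y (u : E) (c l : R) : 0 < c ->
  measurable_fun (unitI R) x -> measurable_fun (unitI R) y -> class_of E y u ->
  lorentz_norm (dilation_norm E) x = l%:E ->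
  exists2 w : E, class_of E (rearrangement2 (tensor x y)) w &
    `|w| <= (c + 4 * l) * `|u|.
Proof.
move=> c0 mx my yu xl.
pose t := shell_time x c; pose lv j := c * 2 ^+ j.
have lv0 j : 0 < lv j by rewrite mulr_gt0// exprn_gt0.
have t01 j : 0 <= t j <= 1 by have [] := shell_superP c j mx.
have t0 j : 0 <= t j by case/andP: (t01 j).
have tS j : t j.+1 <= t j by have [] := shellP j c0 mx.
have [||||j|j|||f [mf f0 fn fw]] := @tensor_domination R x y lv t (shell x c) mx my.
- exact: lexx.
- exact: lv0.
- exact: t0.
- exact: tS.
- by have [] := shellP j c0 mx.
- by have [] := shellP j c0 mx.
- exact: shell_cover.
- by move=> j s; exact: shell_le.
(* The value 0 plays the role of psi(0) = 0: division by 0 would make [dilation 0 y] the constant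
   y(0) instead of 0. *)
pose q j := if 0 < t j then dilation_norm E (t j) else 0.
have vf j : exists v : E, class_of E (f j) v /\ `|v| <= lv j * q j * `|u|.
  have [tj|tj] := ltP 0 (t j).
    have tj1 : 0 < t j <= 1 by rewrite tj; case/andP: (t01 j).
    have my' : measurable_fun (unitI R) (fun s => lv j * y s) by exact: measurable_funM.
    have yu' : class_of E (fun s => lv j * y s) (lv j *: u).
      move: (sym_repZ (lv j) u) yu; apply: lebesgue_aeS2 => s h hu Is.
      by rewrite (h Is) (hu Is).
    have [|v vf vn] := sym_dilation_domination tj1 (mf j) my' yu'.
      by move=> tau tau0; rewrite distributionZ//; exact: fn.
    exists v; split => //; apply: le_trans vn _.
    by rewrite /q tj normrZ gtr0_norm// mulrCA mulrA.
  have tj0 : t j = 0 by apply/eqP; rewrite eq_le tj t0.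
  have [|v vf vn] := @sym_domination R E (f j) 0 (mf j).
    move=> tau tau0; apply: (le_trans (fn _ _ tau0)).
    by rewrite tj0 mul0e measure_ge0.
  exists v; split => //; apply: le_trans vn _.
  by rewrite /q tj0 ltxx mulr0 mul0r normr0.
have [v vP] := choice vf.
(* The factor 4 comes from c 2^(j+1) = 4 (c 2^j / 2): one factor 2 is the passage from the lower to
   the upper level of a shell, the other the halving in the dyadic bound. *)
have sum_le N : \sum_(j < N) lv j.+1 * q j.+1 <= 4 * l.
  have psi0 (r : R) : 0 < r <= 1 -> 0 <= dilation_norm E r by exact: dilation_norm_ge0.
  have := @lorentz_norm_ge R (dilation_norm E) psi0 (@dilation_norm_homo R E) x mx N
    (fun j => c * 2 ^+ j / 2) (fun j => t j.+1).
  rewrite xl lee_fin => H.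
  rewrite -ler_pdivrMl//; apply: le_trans (H _ _ _) => //.
  - rewrite mulr_sumr; apply: ler_sum => j _.
    rewrite mulrA; apply: ler_wpM2r.
      rewrite /q; case: ifPn => // tj; apply: dilation_norm_ge0; rewrite tj/=.
      by case/andP: (t01 j.+1).
    by rewrite /lv exprS; lra.
  - by move=> j; rewrite divr_ge0 ?ler0n// (ltW (lv0 j)).
  - by move=> s /andP[s0 _]; exact: dyadic_rearrangement_ge.
have vM N : \sum_(j < N) `|v j| <= (c + 4 * l) * `|u|.
  have l0 : 0 <= 4 * l by have := sum_le 0%N; rewrite big_ord0.
  case: N => [|N]; first by rewrite big_ord0 mulr_ge0// addr_ge0// ltW.
  apply: (@le_trans _ _ (\sum_(j < N.+1) lv j * q j * `|u|)).
    by apply: ler_sum => j _; case: (vP j).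
  (* The term of index 0 is bounded apart: lv 0 = c and t 0 = 1, with psi(1) <= 1. *)
  rewrite -mulr_suml ler_wpM2r// big_ord_recl/= lerD//; last exact: sum_le.
  rewrite /lv expr0 mulr1 ler_piMr//; first exact: ltW.
  by rewrite /q /t/= ltr01 dilation_norm_le1// ltr01 lexx.
have [j|w wM vw] := sym_series _ vM.
  have [vj _] := vP j; move: vj; apply: lebesgue_aeS => s h Is.
  by rewrite (h Is).
have [mz nz] := rearrangement2_tensor mx my.
have [|z zw zn] := @sym_domination R E _ w mz.
  move=> tau tau0; rewrite nz//; apply: fw => //; first exact: sym_measurable.
  move=> j; have [vj _] := vP j; move: vj (vw j); apply: lebesgue_aeS2 => s h hw Is.
  by rewrite -(h Is) (le_trans (hw Is))// ler_norm.
by exists z => //; exact: le_trans zn wM.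
Qed.

End multiplicator.

Theorem theorem1p6 (R : realType) :
  exists2 C : R, (0 < C)%R &
    forall (E : symmetric_space R) (x : R -> R),
      in_lorentz (dilation_norm E) x ->
      in_multiplicator E x /\
      (multiplicator_norm E x <= C%:E * lorentz_norm (dilation_norm E) x)%E.
Proof.
exists 4 => // E x [mx xoo].
(* The lower bound with an empty sum gives nonnegativity, which excludes the value -oo. *)
have l0 : (0 <= lorentz_norm (dilation_norm E) x)%E.
  have psi0 (r : R) : 0 < r <= 1 -> 0 <= dilation_norm E r by exact: dilation_norm_ge0.
  have := @lorentz_norm_ge R (dilation_norm E) psi0 (@dilation_norm_homo R E) x mx 0%N
    (fun=> 0) (fun=> 0).
  rewrite big_ord0; apply => // [j|s _]; first by rewrite lexx ler01.
  by rewrite big_ord0; exact: rearrangement_ge0.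
move: l0 xoo; case xl : (lorentz_norm (dilation_norm E) x) => [l| |]//.
rewrite lee_fin => l0 _.
split.
  split => // y [my [u yu]].
  (* Membership only needs some positive c, here 1. *)
  have [w wz _] := tensor_bound ltr01 mx my yu xl.
  by have [mz _] := rearrangement2_tensor mx my; split;
    [apply: measurable_tensor => //; exact: measurable_unitI|split => //; exists w].
apply: ge_ereal_sup => _ [y [[my [u yu]] y1] <-].
have u1 : `|u| <= 1 by rewrite -lee_fin -(sym_normE yu).
have [w wz _] := tensor_bound ltr01 mx my yu xl.
rewrite /sym_norm2 (sym_normE wz) -EFinM lee_fin.
(* The vector obtained for each c is the class of the same function, so by injectivity the bound c +
   4 l holds for one fixed vector and c can tend to 0. *)
apply/ler_addgt0Pr => c c0; have [w' wz' w'l] := tensor_bound c0 mx my yu xl.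
rewrite (class_of_inj wz wz') (le_trans w'l)// addrC.
by rewrite ler_piMr// addr_ge0 ?mulr_ge0// ltW.
Qed.
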